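(* For every integer $n\ge 2$, \[ b_2(n)= \begin{cases} \lceil n/2\rceil, & n \text{ is odd},\\ n/2, & n\equiv 0\pmod 8,\\ n/2, & n\equiv 2\pmod 8\text{ and } n\ne 10,\\ n/2+1, & n\equiv 4,6\pmod 8,\\ 6, & n=10. \end{cases} \]
   Context: $K_n$ denotes the complete graph on $n$ vertices. A biclique is a complete bipartite graph; a biclique on a subset of $V(K_n)$ is given by two disjoint sets $X,Y\subseteq V(K_n)$, its edges being all pairs $xy$ with $x\in X$, $y\in Y$. An odd cover of $K_n$ is a finite collection of bicliques on subsets of $V(K_n)$ such that every edge of $K_n$ belongs to an odd number of the bicliques in the collection. $b_2(n)$ denotes the minimum number of bicliques in an odd cover of $K_n$. *)

(* Defs.v *)
From HB Require Import structures.
From mathcomp Require Import all_boot.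

Set Implicit Arguments.
Unset Strict Implicit.
Unset Printing Implicit Defensive.

(* The vertex set of K_n is 'I_n; its edges are the pairs of distinct vertices.
   A part of a biclique may be empty, which gives a biclique without edges. *)

Record biclique (n : nat) : Type := Biclique {
  sides : {set 'I_n} * {set 'I_n};
  sides_disjoint : [disjoint sides.1 & sides.2] }.

HB.instance Definition _ n := [isSub for @sides n].
HB.instance Definition _ n := [Finite of biclique n by <:].

(* Edges are unordered pairs, hence the two ways of placing the endpoints. *)
Definition biclique_edge (n : nat) (B : biclique n) (x y : 'I_n) : bool :=
  (x \in (sides B).1) && (y \in (sides B).2) ||
  (y \in (sides B).1) && (x \in (sides B).2).

(* A collection of bicliques is a sequence, so repetitions are allowed and
   count with multiplicity. *)
Definition odd_cover (n : nat) (c : seq (biclique n)) : bool :=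
  [forall x, forall y, (x != y) ==> odd (count (fun B => biclique_edge B x y) c)].

Definition has_odd_cover (n k : nat) : bool :=
  [exists c : k.-tuple (biclique n), odd_cover c].

Fact star_disjoint n (i : 'I_n) :
  [disjoint ([set i], [set j : 'I_n | i < j]).1
          & ([set i], [set j : 'I_n | i < j]).2].
Proof. by rewrite disjoints1 inE ltnn. Qed.

Fact has_odd_cover_ex (n : nat) : exists k, has_odd_cover n k.
Proof.
pose star (i : 'I_n) : biclique n := Biclique (star_disjoint i).
exists n; apply/existsP; exists [tuple star i | i < n].
apply/forallP=> x; apply/forallP=> y; apply/implyP=> neq_xy.
pose z := if x < y then x else y.
rewrite count_map (@eq_count _ _ (pred1 z)) ?count_uniq_mem ?enum_uniq //;
  first by rewrite mem_enum.
move=> i; rewrite /= /biclique_edge /= !inE /z [x == i]eq_sym [y == i]eq_sym.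
case: (ltngtP x y) => [lt_xy|lt_yx|/val_inj eq_xy].
- case: (i =P x) => [->|_] /=; first by rewrite lt_xy.
  by case: (i =P y) => [->|_] //=; rewrite ltnNge ltnW.
- case: (i =P y) => [->|_] /=; first by rewrite lt_yx orbT.
  by case: (i =P x) => [->|_] //=; rewrite ltnNge ltnW.
- by rewrite eq_xy eqxx in neq_xy.
Qed.

Definition b2 (n : nat) : nat := ex_minn (has_odd_cover_ex n).

(* Main.v *)
Require Import Defs.
From mathcomp Require Import all_boot.
From mathcomp Require Import all_order all_algebra.
From mathcomp Require Import zify ring.

(* Reading each vertex of K_n as a word with one letter per biclique (left, right or
   absent), an odd cover with k bicliques is a set of n words of length k that are
   pairwise opposite in an odd number of positions.

   Lower bounds: over F_2 the indicator matrices A, B of the two letters satisfy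
   A B^T + B A^T = J + 1, so n <= 2k for even n, and when n = 2k the square matrix
   (A | B) is invertible.  Then the hyperbolic form p.q on F_2^(2k) becomes
   S |-> C(|S|, 2) on the subsets of the vertex set; the Gauss sum of the former is
   positive, that of the latter is so only when n = 0, 2 mod 8.  For n = 10 and k = 5
   inverting (A | B) shows that all parts have size 1 mod 4 and that parts of different
   bicliques meet in odd sets; then the two parts of a biclique have size 5 and cover all
   vertices, so they meet a third part in two odd sets that partition it, although its
   size is odd.

   Constructions: the eight nonzero tetracode words give K_8 with four bicliques, and
   such blocks can be added repeatedly to a base cover having two auxiliary words e+ and
   e- that are opposite to each other in an even number of positions and such that each
   word of the base is opposite in an odd number of positions to one of them.  Bases of
   orders 0, 1, 11, 13, 18 suffice, together with K_2, K_3 and K_5. *)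

Set Implicit Arguments.
Unset Strict Implicit.
Unset Printing Implicit Defensive.

(** * Odd covers as words over left, right and absent *)

Definition clash (a b : option bool) : bool :=
  if a is Some x then (if b is Some y then x (+) y else false) else false.

Definition conflict (I : finType) (u v : I -> option bool) : bool :=
  \big[addb/false]_i clash (u i) (v i).

Definition conflicting (T I : finType) (w : T -> I -> option bool) : Prop :=
  forall x y, x != y -> conflict (w x) (w y).

Lemma clashC a b : clash a b = clash b a.
Proof. by case: a b => [[]|] [[]|]. Qed.

Lemma clashxx a : clash a a = false.
Proof. by case: a => [[]|]. Qed.

Lemma conflictC (I : finType) (u v : I -> option bool) :
  conflict u v = conflict v u.
Proof. by apply: eq_bigr => i _; apply: clashC. Qed.

Lemma conflictxx (I : finType) (u : I -> option bool) : conflict u u = false.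
Proof. by apply: big1 => i _; apply: clashxx. Qed.

Lemma odd_count (k : nat) (T : Type) (p : pred T) (c : k.-tuple T) :
  odd (count p c) = \big[addb/false]_(i < k) p (tnth c i).
Proof.
rewrite -[in LHS](map_tnth_enum c) count_map -sum1_count big_enum_cond /=.
rewrite (big_morph odd oddD (erefl _)) big_mkcond.
by apply: eq_bigr => i _ /=; case: ifP.
Qed.

Lemma has_odd_coverP (n k : nat) :
  reflect (exists w : 'I_n -> 'I_k -> option bool, conflicting w)
          (has_odd_cover n k).
Proof.
apply: (iffP existsP) => [[c /forallP cP]|[w wP]].
  exists (fun x t => let B := tnth c t in
    if x \in (sides B).1 then Some true
    else if x \in (sides B).2 then Some false else None) => x y xy.
  have /forallP/(_ y)/implyP/(_ xy) := cP x.
  rewrite odd_count; apply: etrans; apply: eq_bigr => t _; rewrite /biclique_edge.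
  case: (tnth c t) => -[X Y] /= dXY.
  have := disjointFr dXY; move=> dis; move: (dis x) (dis y).
  by case: (x \in X) => [->|_] //; case: (y \in X) => [->|_] //;
    case: (x \in Y); case: (y \in Y).
pose side t b := [set x | w x t == Some b].
have dis t : [disjoint (side t true, side t false).1
                     & (side t true, side t false).2].
  by rewrite disjoint_subset; apply/subsetP=> x; rewrite !inE => /eqP->.
exists [tuple Biclique (dis t) | t < k].
apply/forallP=> x; apply/forallP=> y; apply/implyP=> xy.
rewrite odd_count; apply: etrans (wP x y xy); apply: eq_bigr => t _.
by rewrite tnth_mktuple /biclique_edge /= !inE; case: (w x t) (w y t) => [[]|] [[]|].
Qed.

(** Arbitrary index types let vertices and bicliques form sums and products in the block
    construction. *)
Lemma conflicting_cover (T I : finType) (w : T -> I -> option bool) :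
  conflicting w -> has_odd_cover #|T| #|I|.
Proof.
move=> wP; apply/has_odd_coverP.
exists (fun x t => w (enum_val x) (enum_val t)) => x y xy.
have neq_xy : enum_val x != enum_val y by rewrite (inj_eq enum_val_inj).
apply: etrans (wP _ _ neq_xy).
by rewrite /conflict [RHS](reindex _ (onW_bij _ (@enum_val_bij I))).
Qed.

Lemma has_odd_cover_le (m n k : nat) :
  m <= n -> has_odd_cover n k -> has_odd_cover m k.
Proof.
move=> le_mn /has_odd_coverP[w wP]; apply/has_odd_coverP.
by exists (fun x => w (widen_ord le_mn x)) => x y xy; apply: wP.
Qed.

Lemma conflict_sum (I J K : finType) (u v : I + J * K -> option bool) :
  conflict u v = conflict (fun i => u (inl i)) (fun i => v (inl i))
    (+) \big[addb/false]_j conflict (fun l => u (inr (j, l))) (fun l => v (inr (j, l))).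
Proof.
rewrite /conflict big_sumType /=; congr (_ (+) _).
by rewrite pair_bigA /=; apply: eq_bigr => -[].
Qed.

(** * Adding tetracode blocks to a base cover *)

Definition letter (a : nat) : option bool :=
  nth None [:: None; Some true; Some false] a.

(* Up to sign, the nonzero words of the tetracode, in coordinates where a constant
   word clashes an odd number of times exactly with the words of the opposite sign. *)
Definition tetra (s : bool) (a b : 'I_4) : option bool :=
  omap (addb (~~ s)) (letter (nth 0 (nth [::]
    [:: [:: 0; 1; 1; 1]; [:: 2; 0; 1; 2]; [:: 2; 2; 0; 1]; [:: 2; 1; 2; 0]] a) b)).

Lemma conflict_tetra s a s' a' :
  conflict (tetra s a) (tetra s' a') = ((s, a) != (s', a')).
Proof.
rewrite /conflict !big_ord_recl big_ord0.
by case: s a s' a' => -[[|[|[|[|//]]]] ?] [] [[|[|[|[|//]]]] ?].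
Qed.

Lemma conflict_const (o o' : option bool) :
  conflict (fun _ : 'I_4 => o) (fun _ => o') = false.
Proof. by rewrite /conflict !big_ord_recl big_ord0; case: clash. Qed.

(** A word of sign [s] has an odd number of letters [s] and an even number of opposite ones. *)
Lemma conflict_const_tetra o s a :
  conflict (fun _ : 'I_4 => o) (tetra s a) = clash o (Some s).
Proof.
rewrite /conflict !big_ord_recl big_ord0.
by case: o s a => [[]|] [] -[[|[|[|[|//]]]] ?].
Qed.

(** [e s] is the word that all block words of sign [s] carry on the base coordinates. *)
Definition extendable (n k : nat) (w : 'I_n -> 'I_k -> option bool)
    (e : bool -> 'I_k -> option bool) : Prop :=
  [/\ conflicting w, conflict (e true) (e false) = false
    & forall x, conflict (w x) (e true) || conflict (w x) (e false)].

(* In the coordinates of the j-th block, a word of the base is constant (or absent), and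
   a word of the i-th block is constant with its sign if i < j, with the opposite sign
   if j < i: this antisymmetry makes words of different blocks
   clash an odd number of times. *)
Lemma extendable_cover (n k m : nat) (w : 'I_n -> 'I_k -> option bool) e :
  extendable w e -> has_odd_cover (n + 8 * m) (k + 4 * m).
Proof.
move=> [wP eP weP].
pose T : finType := ('I_n + 'I_m * (bool * 'I_4))%type.
pose I : finType := ('I_k + 'I_m * 'I_4)%type.
(* A base word conflicting with [e s] only takes the letter [s], which clashes with the block words
   of the other sign. *)
pose tau x := if conflict (w x) (e true) && conflict (w x) (e false) then None
              else Some (conflict (w x) (e true)).
pose W (z : T) (c : I) : option bool := match z, c with
  | inl x, inl t => w x t
  | inl x, inr _ => tau x
  | inr (_, (s, _)), inl t => e s t
  | inr (i, (s, a)), inr (j, b) =>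
      if j == i then tetra s a b else Some (s (+) (j < i))
  end.
have -> : n + 8 * m = #|T|.
  by rewrite card_sum !card_prod card_bool !card_ord mulnC.
have -> : k + 4 * m = #|I| by rewrite card_sum card_prod !card_ord mulnC.
apply: (@conflicting_cover T I W).
have mixed x i s a : conflict (W (inl x)) (W (inr (i, (s, a)))).
  rewrite conflict_sum /= (bigD1 i) //= eqxx big1 => [|j /negPf->]; last first.
    exact: conflict_const.
  rewrite (conflict_const_tetra (tau x)) addbF /tau.
  have := weP x; rewrite -/(conflict (w x) (e s)).
  by case: s; case: (conflict (w x) (e true)); case: (conflict (w x) (e false)).
move=> [x|[i [s a]]] [y|[i' [s' a']]] zz' //.
- rewrite conflict_sum /= big1 => [|j _]; last exact: conflict_const.
  by rewrite addbF; apply: wP.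
- by rewrite conflictC.
have ee : conflict (e s) (e s') = false.
  by case: s s' {zz'} => -[]; rewrite ?conflictxx // conflictC.
rewrite conflict_sum /= -/(conflict (e s) (e s')) ee addFb.
have [eq_ii'|neq_ii'] := eqVneq i i'.
  subst i'; rewrite (bigD1 i) //= eqxx big1 => [|j /negPf->]; last first.
    exact: conflict_const.
  rewrite (conflict_tetra s a s' a') addbF.
  by apply: contra zz' => /eqP[-> ->].
rewrite (bigD1 i) //= (bigD1 i') 1?eq_sym //= !eqxx big1 => [|j /andP[/negPf-> /negPf->]];
  last exact: conflict_const.
rewrite [i' == i]eq_sym (negPf neq_ii').
rewrite (conflictC (tetra s a)) (conflict_const_tetra (Some _)).
rewrite (conflict_const_tetra (Some _)) addbF /=.
have := neq_ii'; rewrite neq_ltn.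
by case: ltngtP => // _ _; case: s s' {zz' ee} => -[].
Qed.

(** * Explicit base covers *)

Definition word (k : nat) (s : seq nat) (i : 'I_k) : option bool :=
  letter (nth 0 s i).

(** Evaluable form of [conflict], by which explicit codes are checked. *)
Definition clashes (k : nat) (s t : seq nat) : bool :=
  foldr (fun i b => clash (letter (nth 0 s i)) (letter (nth 0 t i)) (+) b)
    false (iota 0 k).

Lemma conflict_word k s t : conflict (@word k s) (@word k t) = clashes k s t.
Proof.
rewrite /conflict /word /clashes.
rewrite -(big_mkord xpredT (fun i => clash (letter (nth 0 s i)) (letter (nth 0 t i)))).
by rewrite /index_iota subn0 unlock.
Qed.

Definition codebook (n k : nat) (c : seq (seq nat)) (x : 'I_n) : 'I_k -> option bool :=
  @word k (nth [::] c x).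

Lemma codebook_conflicting n k c :
  all (fun x => all (fun y => (x == y) || clashes k (nth [::] c x) (nth [::] c y))
    (iota 0 n)) (iota 0 n) -> conflicting (@codebook n k c).
Proof.
move/allP=> cP x y xy; rewrite /codebook conflict_word.
have xn : val x \in iota 0 n by rewrite mem_iota /=.
have yn : val y \in iota 0 n by rewrite mem_iota /=.
by have /allP/(_ _ yn)/orP[/eqP/val_inj/eqP|//] := cP _ xn; rewrite (negPf xy).
Qed.

Lemma codebook_extendable n k c s t :
  all (fun x => all (fun y => (x == y) || clashes k (nth [::] c x) (nth [::] c y))
    (iota 0 n)) (iota 0 n) ->
  ~~ clashes k s t ->
  all (fun x => clashes k (nth [::] c x) s || clashes k (nth [::] c x) t) (iota 0 n) ->
  extendable (@codebook n k c) (fun b => @word k (if b then s else t)).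
Proof.
move=> cP stP /allP eP; split; first exact: codebook_conflicting.
  by rewrite conflict_word (negPf stP).
by move=> x; rewrite /codebook !conflict_word; apply: eP; rewrite mem_iota /=.
Qed.

Lemma has_odd_cover_2_1 : has_odd_cover 2 1.
Proof.
apply/has_odd_coverP; exists (@codebook 2 1 [:: [:: 1]; [:: 2]]).
by apply: codebook_conflicting; vm_compute.
Qed.

Lemma has_odd_cover_3_2 : has_odd_cover 3 2.
Proof.
apply/has_odd_coverP; exists (@codebook 3 2 [:: [:: 1; 0]; [:: 2; 1]; [:: 2; 2]]).
by apply: codebook_conflicting; vm_compute.
Qed.

Lemma has_odd_cover_mod0 m : has_odd_cover (0 + 8 * m) (0 + 4 * m).
Proof.
apply/extendable_cover/(@codebook_extendable 0 0 [::] [::] [::]); by vm_compute.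
Qed.

Lemma has_odd_cover_mod1 m : has_odd_cover (1 + 8 * m) (1 + 4 * m).
Proof.
apply/extendable_cover/(@codebook_extendable 1 1 [:: [:: 1]] [:: 2] [:: 2]); by vm_compute.
Qed.

Lemma has_odd_cover_5_3 : has_odd_cover 5 3.
Proof.
apply/has_odd_coverP; exists (@codebook 5 3
  [:: [:: 0; 1; 1]; [:: 1; 0; 2]; [:: 1; 2; 1]; [:: 2; 1; 2]; [:: 2; 2; 0]]).
by apply: codebook_conflicting; vm_compute.
Qed.

Lemma has_odd_cover_mod3 m : has_odd_cover (11 + 8 * m) (6 + 4 * m).
Proof.
apply/extendable_cover/(@codebook_extendable 11 6
  [:: [:: 1; 0; 2; 1; 2; 2]; [:: 2; 1; 1; 1; 1; 2]; [:: 0; 1; 1; 1; 1; 1];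
      [:: 1; 2; 1; 0; 2; 2]; [:: 1; 1; 1; 1; 0; 2]; [:: 0; 2; 0; 1; 1; 0];
      [:: 1; 0; 0; 0; 2; 1]; [:: 2; 0; 0; 0; 2; 0]; [:: 0; 0; 1; 2; 1; 0];
      [:: 1; 1; 0; 2; 2; 2]; [:: 0; 1; 2; 0; 1; 0]]
  [:: 1; 2; 1; 2; 1; 2] [:: 0; 0; 1; 1; 1; 1]); by vm_compute.
Qed.

Lemma has_odd_cover_mod5 m : has_odd_cover (13 + 8 * m) (7 + 4 * m).
Proof.
apply/extendable_cover/(@codebook_extendable 13 7
  [:: [:: 2; 0; 0; 1; 1; 1; 1]; [:: 2; 0; 0; 2; 2; 0; 2];
      [:: 0; 0; 0; 0; 0; 2; 1]; [:: 1; 0; 1; 1; 0; 1; 1];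
      [:: 2; 1; 1; 1; 2; 1; 0]; [:: 2; 1; 1; 1; 2; 2; 2];
      [:: 2; 2; 1; 0; 2; 1; 1]; [:: 1; 1; 0; 0; 2; 0; 2];
      [:: 0; 0; 2; 0; 2; 1; 1]; [:: 2; 1; 2; 1; 0; 0; 2];
      [:: 0; 1; 1; 0; 1; 0; 2]; [:: 0; 2; 0; 1; 0; 0; 2];
      [:: 0; 1; 1; 2; 0; 1; 1]]
  [:: 0; 0; 2; 1; 2; 1; 0] [:: 0; 2; 1; 2; 0; 1; 0]); by vm_compute.
Qed.

(* The base words are (f (x g))_(1 <= g <= 9) for x = 1, ..., 18, where f : F_19 -> F_3
   is odd with values 0, 0, 0, 1, 0, 1, 1, 1, 1 on 1, ..., 9. *)
Lemma has_odd_cover_mod2 m : has_odd_cover (18 + 8 * m) (9 + 4 * m).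
Proof.
apply/extendable_cover/(@codebook_extendable 18 9
  [:: [:: 0; 0; 0; 1; 0; 1; 1; 1; 1]; [:: 0; 1; 1; 1; 2; 2; 0; 0; 0];
      [:: 0; 1; 1; 2; 2; 0; 0; 0; 1]; [:: 1; 1; 2; 0; 0; 0; 1; 2; 0];
      [:: 0; 2; 2; 0; 1; 2; 0; 0; 1]; [:: 1; 2; 0; 0; 2; 0; 1; 2; 0];
      [:: 1; 0; 0; 1; 0; 1; 2; 0; 1]; [:: 1; 0; 0; 2; 0; 2; 0; 1; 2];
      [:: 1; 0; 1; 0; 1; 0; 1; 2; 0]; [:: 2; 0; 2; 0; 2; 0; 2; 1; 0];
      [:: 2; 0; 0; 1; 0; 1; 0; 2; 1]; [:: 2; 0; 0; 2; 0; 2; 1; 0; 2];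
      [:: 2; 1; 0; 0; 1; 0; 2; 1; 0]; [:: 0; 1; 1; 0; 2; 1; 0; 0; 2];
      [:: 2; 2; 1; 0; 0; 0; 2; 1; 0]; [:: 0; 2; 2; 1; 1; 0; 0; 0; 2];
      [:: 0; 2; 2; 2; 1; 1; 0; 0; 0]; [:: 0; 0; 0; 2; 0; 2; 2; 2; 2]]
  [:: 0; 0; 0; 0; 0; 1; 1; 1; 1] [:: 0; 0; 1; 2; 1; 0; 0; 0; 1]); by vm_compute.
Qed.

(** * Gram matrices over F_2 and rank bounds *)

Section LowerBounds.
Import Order.TTheory GRing.Theory Num.Theory.
Local Open Scope ring_scope.


Lemma natrF2 (m : nat) : m%:R = (odd m)%:R :> 'F_2.
Proof.
have two0 : 2%:R = 0 :> 'F_2 by apply/val_inj.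
by rewrite -[m in LHS]odd_double_half natrD -muln2 natrM two0 mulr0 addr0.
Qed.

Lemma addF2 (x : 'F_2) : x + x = 0.
Proof. by rewrite -mulr2n -mulr_natl natrF2 mul0r. Qed.

Definition letter_mx (n k : nat) (w : 'I_n -> 'I_k -> option bool) (b : bool) :
    'M['F_2]_(n, k) :=
  \matrix_(i, t) (w i t == Some b)%:R.

Definition neq_mx (n : nat) : 'M['F_2]_n := \matrix_(i, j) (i != j)%:R.

Lemma letter_mx_gram n k (w : 'I_n -> 'I_k -> option bool) :
  conflicting w ->
  letter_mx w true *m (letter_mx w false)^T + letter_mx w false *m (letter_mx w true)^T
  = neq_mx n.
Proof.
move=> wP; apply/matrixP=> i j; rewrite !mxE -big_split /=.
transitivity ((conflict (w i) (w j))%:R : 'F_2).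
  have addm : {morph (fun b : bool => b%:R : 'F_2) : a b / a (+) b >-> a + b}.
    by move=> [] []; apply/val_inj.
  rewrite /conflict (big_morph _ addm (erefl _)).
  by apply: eq_bigr => t _; rewrite !mxE; case: (w i t) (w j t) => [[]|] [[]|];
    apply/val_inj.
have [->|neq_ij] := eqVneq i j; first by rewrite conflictxx.
by rewrite wP.
Qed.

Lemma letter_mx_disjoint n k (w : 'I_n -> 'I_k -> option bool) i t :
  letter_mx w true i t * letter_mx w false i t = 0.
Proof. by rewrite !mxE; case: (w i t) => [[]|]; apply/val_inj. Qed.

Lemma neq_mxE n : neq_mx n = const_mx 1 + 1%:M.
Proof. by apply/matrixP=> i j; rewrite !mxE; case: eqP => _; apply/val_inj. Qed.

Lemma mul_ones m n p :
  (const_mx 1 : 'M['F_2]_(m, n)) *m (const_mx 1 : 'M_(n, p)) = const_mx (odd n)%:R.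
Proof.
apply/matrixP=> i j; rewrite !mxE (eq_bigr (fun=> 1)) => [|l _].
  by rewrite sumr_const card_ord; apply: natrF2.
by rewrite !mxE mul1r.
Qed.

(** The matrix is J + 1, and J^2 = n J vanishes for even n. *)
Lemma neq_mx_involution n : ~~ odd n -> neq_mx n *m neq_mx n = 1%:M.
Proof.
move=> /negPf n_even; rewrite neq_mxE mulmxDl !mulmxDr !mulmx1 mul1mx mul_ones n_even.
by apply/matrixP=> i j; rewrite !mxE add0r addrA addF2 add0r.
Qed.

(** J + 1 has rank n, and each of the two products in the Gram identity has rank at most k. *)
Lemma cover_lower_even n k : ~~ odd n -> has_odd_cover n k -> (n <= k + k)%N.
Proof.
move=> n_even /has_odd_coverP[w /letter_mx_gram gram].
have: \rank (neq_mx n) = n.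
  by apply/eqP; rewrite mxrank_unit //; case/mulmx1_unit: (neq_mx_involution n_even).
rewrite -gram => <-; apply: leq_trans (mxrank_add _ _) _.
by apply: leq_add; apply: leq_trans (mxrankM_maxl _ _) (rank_leq_col _).
Qed.

(** The Gram identity reads M N^T = J + 1; as M is square, its right inverse N^T (J + 1) is also a
    left inverse. *)
Lemma dual_gram k (w : 'I_(k + k) -> 'I_k -> option bool) :
  conflicting w ->
  let M := row_mx (letter_mx w true) (letter_mx w false) in
  let N := row_mx (letter_mx w false) (letter_mx w true) in
  N^T *m neq_mx (k + k) *m M = 1%:M.
Proof.
move=> wP M N; apply: mulmx1C; rewrite mulmxA /M /N tr_row_mx mul_row_col.
by rewrite (letter_mx_gram wP) neq_mx_involution // addnn odd_double.
Qed.

Lemma dual_gram_blocks k (w : 'I_(k + k) -> 'I_k -> option bool) (b c : bool) :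
  conflicting w ->
  (letter_mx w b)^T *m neq_mx (k + k) *m letter_mx w c = (b != c)%:R%:M.
Proof.
move=> /dual_gram; rewrite /= tr_row_mx mul_col_mx mul_col_row scalar_mx_block.
by case/eq_block_mx; case: b c => [] [] /=; rewrite ?scalemx1 ?raddf0.
Qed.

(* Deleting a vertex of a cover of odd order n = 2k+1 leaves vectors spanning the
   whole space, so the deleted vector is the sum of the others; but by duality
   every part of the remaining bicliques is odd, so this sum has both letters in
   every coordinate. *)
Lemma no_cover_odd k : (0 < k)%N -> ~~ has_odd_cover (k + k).+1 k.
Proof.
move=> k_gt0; apply/negP=> /has_odd_coverP[w wP].
pose v i := w (lift ord_max i).
have vP : conflicting v by move=> x y xy; apply: wP; rewrite (inj_eq lift_inj).
pose A := letter_mx v true; pose B := letter_mx v false.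
pose a : 'rV_k := row ord_max (letter_mx w true).
pose b : 'rV_k := row ord_max (letter_mx w false).
pose M := row_mx A B; pose N := row_mx B A.
have dual : N^T *m neq_mx (k + k) *m M = 1%:M := dual_gram vP.
have last_gram : M *m (row_mx b a)^T = const_mx 1.
  apply/matrixP=> i j; have := letter_mx_gram wP.
  move/matrixP/(_ (lift ord_max i) ord_max); rewrite tr_row_mx mul_row_col !mxE.
  rewrite eq_sym neq_lift; apply: etrans.
  by congr (_ + _); apply: eq_bigr => t _; rewrite !mxE.
have ones : neq_mx (k + k) *m const_mx 1 = const_mx 1 :> 'cV_(k + k).
  rewrite neq_mxE mulmxDl mul1mx mul_ones addnn odd_double.
  by apply/matrixP=> i j; rewrite !mxE add0r.
have ba : (row_mx b a)^T = N^T *m const_mx 1.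
  by rewrite -[LHS]mul1mx -dual -!mulmxA last_gram ones.
pose t : 'I_k := Ordinal k_gt0.
pose sumA := \sum_i A i t; pose sumB := \sum_i B i t.
have sumAE : a 0 t = sumA.
  move/matrixP/(_ (rshift k t) 0): ba; rewrite [LHS]mxE row_mxEr => ->; rewrite mxE.
  by apply: eq_bigr => i _; rewrite mxE row_mxEr [X in _ * X]mxE mulr1.
have sumBE : b 0 t = sumB.
  move/matrixP/(_ (lshift k t) 0): ba; rewrite [LHS]mxE row_mxEl => ->; rewrite mxE.
  by apply: eq_bigr => i _; rewrite mxE row_mxEl [X in _ * X]mxE mulr1.
(* For disjoint parts X, Y of one biclique, the diagonal entry of A^T (J + 1) B is |X| |Y|. *)
have sumAB : sumA * sumB = 1.
  have /matrixP/(_ t t) := dual_gram_blocks true false vP.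
  rewrite neq_mxE mulmxDr mulmx1 mulmxDl !mxE eqxx mulr1n.
  rewrite [X in _ + X]big1 => [|i _]; last by rewrite mxE letter_mx_disjoint.
  rewrite addr0 => eq1; apply: etrans eq1; rewrite mulr_sumr; apply: eq_bigr => i _.
  by rewrite !mxE; congr (_ * _); apply: eq_bigr => l _; rewrite !mxE mulr1.
have := letter_mx_disjoint w ord_max t.
have -> : letter_mx w true ord_max t = a 0 t by rewrite !mxE.
have -> : letter_mx w false ord_max t = b 0 t by rewrite !mxE.
by rewrite sumAE sumBE sumAB => /eqP; rewrite oner_eq0.
Qed.


(** * The quadratic form on vertex sets and the parities of parts *)

Lemma F2P (x : 'F_2) : x = (x != 0)%:R.
Proof. by case: x => -[|[|//]] ?; apply/val_inj. Qed.

Lemma natrF2_inj (x y : bool) : x%:R = y%:R :> 'F_2 -> x = y.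
Proof. by case: x y => [] []. Qed.

Lemma natrF2_eq0 (m : nat) : (m%:R == 0 :> 'F_2) = ~~ odd m.
Proof. by rewrite natrF2; case: odd. Qed.

(** As for the arcs of a tournament, each unordered pair contributes 1. *)
Lemma sum_orientation (T : eqType) (c : T -> T -> 'F_2) (s : seq T) :
  (forall i, c i i = 0) -> (forall i j, i != j -> c i j + c j i = 1) ->
  uniq s -> \sum_(i <- s) \sum_(j <- s) c i j = 'C(size s, 2)%:R.
Proof.
move=> c0 c1; elim: s => [|x s IHs] /=; first by rewrite big_nil.
move=> /andP[xs /IHs{}IHs]; rewrite big_cons big_cons c0 add0r.
under [X in _ + X]eq_bigr do rewrite big_cons.
rewrite big_split /= IHs addrA -big_split /= binS bin1 natrD addrC; congr (_ + _).
rewrite (eq_big_seq (fun=> 1)) => [|i si].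
  by rewrite big_const_seq count_predT iter_addr addr0.
by apply: c1; apply: contraNneq xs => ->.
Qed.

Definition indicator (n : nat) (S : {set 'I_n}) : 'rV['F_2]_n :=
  \row_i (i \in S)%:R.

Lemma indicator_bij n : bijective (@indicator n).
Proof.
exists (fun u : 'rV_n => [set i | u 0 i != 0]) => [S|u].
  by apply/setP=> i; rewrite inE mxE; case: (i \in S).
by apply/rowP=> i; rewrite mxE inE -F2P.
Qed.

(** A B^T is such an orientation: its diagonal is zero, and adding its transpose gives J + 1. *)
Lemma indicator_quad n k (w : 'I_n -> 'I_k -> option bool) (S : {set 'I_n}) :
  conflicting w ->
  ((indicator S *m letter_mx w true) *m (indicator S *m letter_mx w false)^T) 0 0
  = 'C(#|S|, 2)%:R.
Proof.
move=> wP; set A := letter_mx w true; set B := letter_mx w false.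
have -> : 'C(#|S|, 2)%:R =
    \sum_(i <- enum S) \sum_(j <- enum S) (A *m B^T) i j :> 'F_2.
  rewrite sum_orientation ?enum_uniq ?cardE // => [i|i j neq_ij].
    by rewrite mxE big1 // => t _; rewrite [X in _ * X]mxE letter_mx_disjoint.
  have -> : (A *m B^T) j i = (B *m A^T) i j by rewrite -[B]trmxK -trmx_mul trmxK [RHS]mxE.
  by have /matrixP/(_ i j) := letter_mx_gram wP; rewrite !mxE neq_ij.
rewrite trmx_mul mulmxA -(mulmxA (indicator S)) big_enum exchange_big big_enum /=.
rewrite mxE [RHS]big_mkcond; apply: eq_bigr => j _; rewrite !mxE.
rewrite [in RHS]big_mkcond /=; case: (j \in S); last first.
  by rewrite mulr0.
rewrite mulr1; apply: eq_bigr => i _; rewrite mxE.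
by case: (i \in S); rewrite ?mul1r ?mul0r.
Qed.

Definition part n k (w : 'I_n -> 'I_k -> option bool) (b : bool) (t : 'I_k) : {set 'I_n} :=
  [set x | w x t == Some b].

Lemma letter_mx_part n k (w : 'I_n -> 'I_k -> option bool) b x t :
  letter_mx w b x t = (x \in part w b t)%:R.
Proof. by rewrite mxE inE. Qed.

Lemma sum_indicator (n : nat) (S : {set 'I_n}) :
  \sum_i (i \in S)%:R = (odd #|S|)%:R :> 'F_2.
Proof.
by rewrite -natrF2 -sum1_card natr_sum [RHS]big_mkcond; apply: eq_bigr => i _; case: (i \in S).
Qed.

(** Thus J + 1 complements the parts of odd size and fixes the others. *)
Lemma letter_mx_neq n k (w : 'I_n -> 'I_k -> option bool) b t j :
  ((letter_mx w b)^T *m neq_mx n) t j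
  = (odd #|part w b t|)%:R + (j \in part w b t)%:R.
Proof.
rewrite neq_mxE mulmxDr mulmx1 mxE [X in _ + X]mxE letter_mx_part -sum_indicator.
by rewrite mxE; congr (_ + _); apply: eq_bigr => i _; rewrite !mxE mulr1 inE.
Qed.

Lemma part_disjoint n k (w : 'I_n -> 'I_k -> option bool) b t :
  part w b t :&: part w (~~ b) t = set0.
Proof. by apply/setP=> x; rewrite !inE; case: (w x t) b => [[]|] []. Qed.

Lemma part_parity k (w : 'I_(k + k) -> 'I_k -> option bool) b c t s :
  conflicting w ->
  (odd #|part w b t| && odd #|part w c s|) (+) odd #|part w b t :&: part w c s|
  = (b != c) && (t == s).
Proof.
move=> wP; apply: natrF2_inj; have /matrixP/(_ t s) := dual_gram_blocks b c wP.
rewrite [in RHS]mxE -mulrnA mulnb => <-; rewrite mxE.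
under eq_bigr do rewrite letter_mx_neq letter_mx_part mulrDl.
rewrite big_split /= -mulr_sumr sum_indicator.
have -> : \sum_i (i \in part w b t)%:R * (i \in part w c s)%:R
  = (odd #|part w b t :&: part w c s|)%:R :> 'F_2.
  by rewrite -sum_indicator; apply: eq_bigr => i _; rewrite in_setI -natrM mulnb.
by case: odd; case: odd; case: odd; apply/val_inj.
Qed.

Lemma part_odd k (w : 'I_(k + k) -> 'I_k -> option bool) b t :
  conflicting w -> odd #|part w b t|.
Proof.
move=> wP; have := part_parity b (~~ b) t t wP; rewrite part_disjoint cards0 addbF eqxx.
have -> : b != ~~ b by case: (b).
by case/andP.
Qed.

Lemma partI_odd k (w : 'I_(k + k) -> 'I_k -> option bool) b c t s :
  conflicting w -> t != s -> odd #|part w b t :&: part w c s|.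
Proof.
move=> wP neq_ts; have := part_parity b c t s wP.
by rewrite !(part_odd _ _ wP) (negPf neq_ts) andbF; case: odd.
Qed.

(** The complement of an odd part is a row of P^T (J + 1), where P is [letter_mx w b]; by duality P
    sends it to 0, so the form vanishes there. *)
Lemma part_compl_bin k (w : 'I_(k + k) -> 'I_k -> option bool) b t :
  conflicting w -> ~~ odd 'C(#|~: part w b t|, 2).
Proof.
move=> wP; rewrite -natrF2_eq0 -(indicator_quad _ wP).
have -> : indicator (~: part w b t) = row t ((letter_mx w b)^T *m neq_mx _).
  apply/rowP=> j; rewrite [RHS]mxE letter_mx_neq (part_odd b t wP) mxE in_setC.
  by case: (j \in _); apply/val_inj.
rewrite -!row_mul !dual_gram_blocks //.
by case: b; rewrite ?scale0r ?raddf0 ?row0 ?mul0mx ?trmx0 ?mulmx0 ?mxE.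
Qed.

Lemma no_cover_10 : ~~ has_odd_cover 10 5.
Proof.
apply/negP=> /has_odd_coverP[w wP].
have {}wP : @conflicting 'I_(5 + 5) 'I_5 w by [].
(* Size 1 cannot hold two disjoint odd subsets; size 3 leaves a complement of size 7, and C(7, 2) =
   21 is odd. *)
have wide b t : (4 < #|part w b t|)%N.
  have [s neq_ts] : exists s : 'I_5, t != s.
    by case: t => -[|m] ?; [exists ord_max | exists ord0].
  have := partI_odd b true wP neq_ts; have := partI_odd b false wP neq_ts.
  have := part_compl_bin b t wP; have := part_odd b t wP.
  have := cardsC (part w b t); rewrite card_ord.
  have /subset_leq_card : (part w b t :&: part w true s) :|: (part w b t :&: part w false s)
      \subset part w b t.
    by rewrite subUset !subsetIl.
  rewrite cardsU setIACA (part_disjoint w true s) setI0 cards0 subn0.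
  case: #|_ :&: part w true s| => [//|x]; case: #|_ :&: part w false s| => [//|y].
  case: #|part w b t| => [|[|[|[|[|//]]]]] //; first by rewrite addSn addnS.
  by move=> _; case: #|~: _| => [|[|[|[|[|[|[|[|]]]]]]]].
pose t : 'I_5 := ord0; pose s : 'I_5 := ord_max.
have cover : part w true s :|: part w false s = setT.
  apply/eqP; rewrite eqEcard subsetT cardsT card_ord cardsU (part_disjoint w true s) cards0 subn0.
  by have := wide true s; have := wide false s; lia.
have := part_odd true t wP.
rewrite -[part w true t]setIT -cover setIUr cardsU setIACA
  (part_disjoint w true s) setI0 cards0 subn0.
by rewrite oddD !partI_odd.
Qed.


(** * Gauss sums for the nontrivial character of F_2 *)

Definition charF2 (x : 'F_2) : int := if x == 0 then 1 else -1.

Lemma charF2D x y : charF2 (x + y) = charF2 x * charF2 y.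
Proof. by rewrite (F2P x) (F2P y); case: (x != 0) (y != 0) => [] []. Qed.

Lemma charF2_nat m : charF2 m%:R = (-1) ^+ m.
Proof. by rewrite /charF2 natrF2_eq0 -signr_odd; case: odd. Qed.

(** Translation by a unit vector where p is nonzero negates every term. *)
Lemma sum_charF2_dot k (p : 'rV['F_2]_k) :
  p != 0 -> \sum_(q : 'rV['F_2]_k) charF2 ((p *m q^T) 0 0) = 0.
Proof.
case/rV0Pn=> t pt; set f := fun q : 'rV_k => charF2 ((p *m q^T) 0 0).
pose d : 'rV['F_2]_k := delta_mx 0 t.
have pd : (p *m d^T) 0 0 = p 0 t by rewrite /d trmx_delta -colE mxE.
have fD q : f (q + d) = - f q.
  by rewrite /f raddfD mulmxDr mxE charF2D pd {2}/charF2 (negPf pt) mulrN1.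
have: \sum_q f q = - \sum_q f q.
  rewrite {1}(reindex (fun q => q + d)) -?sumrN; first by apply: eq_bigr.
  by exists (fun q => q - d) => q _; rewrite ?addrK ?subrK.
by move: (\sum_q f q) => x; lia.
Qed.

(** Only the left half 0 survives summation over right halves, and it contributes their number. *)
Lemma sum_charF2_hyperbolic k :
  0 < \sum_(x : 'rV['F_2]_(k + k)) charF2 ((lsubmx x *m (rsubmx x)^T) 0 0).
Proof.
pose join (pq : 'rV['F_2]_k * 'rV['F_2]_k) := row_mx pq.1 pq.2.
rewrite (reindex join); last first.
  exists (fun x => (lsubmx x, rsubmx x)) => [[p q]|x] _ /=.
    by rewrite row_mxKl row_mxKr.
  exact: hsubmxK.
under eq_bigr do rewrite row_mxKl row_mxKr.
rewrite -(pair_bigA _ (fun p q : 'rV_k => charF2 ((p *m q^T) 0 0))) /=.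
rewrite (bigD1 0) //= [X in _ + X]big1 => [|p]; last exact: sum_charF2_dot.
rewrite addr0 (eq_bigr (fun=> 1)) => [|q _]; last by rewrite mul0mx mxE.
by rewrite sumr_const -[_ *+ _]/((_)%:R) ltr0n; apply/card_gt0P; exists 0.
Qed.

Definition gauss (n : nat) (f : nat -> int) : int :=
  \sum_(m < n.+1) f m *+ 'C(n, m).

Lemma sum_sets_gauss n f : \sum_(S : {set 'I_n}) f #|S| = gauss n f.
Proof.
have card_lt (S : {set 'I_n}) : (#|S| < n.+1)%N.
  by rewrite ltnS -[n in (_ <= n)%N]card_ord max_card.
rewrite (partition_big (fun S => Ordinal (card_lt S)) xpredT) //=.
apply: eq_bigr => m _; rewrite (eq_bigr (fun=> f m)) => [|S /eqP<-] //.
rewrite sumr_const; congr (_ *+ _).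
by rewrite -[n in 'C(n, _)]card_ord -[RHS]card_draws cardsE.
Qed.

Lemma gaussS n f : gauss n.+1 f = gauss n f + gauss n (f \o succn).
Proof.
rewrite {1}/gauss big_ord_recl bin0 /=.
under eq_bigr do rewrite /bump binS mulrnDr.
rewrite big_split /= addrA; congr (_ + _).
by rewrite /gauss [RHS]big_ord_recl bin0 big_ord_recr /= bin_small // mulr0n addr0.
Qed.

Definition sgn_bin (m : nat) : int := (-1) ^+ 'C(m, 2).

Lemma sgn_binSS m : sgn_bin m.+2 = - sgn_bin m.
Proof.
have -> : sgn_bin m.+2 = (-1) ^+ ('C(m, 2) + 2 * m).+1.
  by rewrite /sgn_bin !binS !bin1 bin0; congr (_ ^+ _); lia.
by rewrite exprS exprD exprM sqrrN !expr1n mulr1 mulN1r.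
Qed.

(** Pascal's rule four times gives coefficients 1, 4, 6, 4, 1; as a double shift negates, they
    collapse to 1 - 6 + 1 = -4 and 4 - 4 = 0. *)
Lemma gauss_add4 n : gauss n.+4 sgn_bin = - 4%:R * gauss n sgn_bin.
Proof.
have opp g : (forall m, g m.+2 = - g m) -> gauss n (g \o succn \o succn) = - gauss n g.
  by move=> gP; rewrite /gauss -sumrN; apply: eq_bigr => i _; rewrite /= gP mulNrn.
have s2 := opp sgn_bin sgn_binSS.
have s3 := opp (sgn_bin \o succn) (fun m => sgn_binSS m.+1).
have s4 := opp (sgn_bin \o succn \o succn) (fun m => sgn_binSS m.+2).
by rewrite !gaussS s4 s3 s2; ring.
Qed.

Lemma gauss_gt0 n : ~~ odd n -> (0 < gauss n sgn_bin) = (n %% 8 < 4)%N.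
Proof.
have gauss_add8 m q : gauss (m + 8 * q) sgn_bin = 16%:R ^+ q * gauss m sgn_bin.
  elim: q => [|q IHq]; first by rewrite muln0 addn0 mul1r.
  have -> : (m + 8 * q.+1 = (m + 8 * q).+4.+4)%N by lia.
  by rewrite !gauss_add4 IHq exprS; ring.
have gauss0 : gauss 0 sgn_bin = 1 by rewrite /gauss big_ord1.
have gauss2 : gauss 2 sgn_bin = 2 by rewrite !gaussS /gauss !big_ord1.
move=> n_even; rewrite {1}(divn_eq n 8) addnC mulnC gauss_add8.
rewrite pmulr_rgt0 ?exprn_gt0 //.
have : ~~ odd (n %% 8) by move: n_even; rewrite {1}(divn_eq n 8) oddD oddM andbF.
case: (n %% 8)%N (ltn_pmod n (isT : 0 < 8)%N) => [|[|[|[|[|[|[|[|//]]]]]]]] // _ _;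
  by rewrite ?gauss_add4 ?gauss0 ?gauss2.
Qed.

Lemma cover_tight_mod8 k : has_odd_cover (k + k) k -> ((k + k) %% 8 < 4)%N.
Proof.
move=> /has_odd_coverP[w wP]; rewrite -gauss_gt0 ?addnn ?odd_double // -addnn.
pose M := row_mx (letter_mx w true) (letter_mx w false).
have [M' M'M] : exists M', M' *m M = 1%:M by eexists; apply: dual_gram wP.
have MM' := mulmx1C M'M.
rewrite -sum_sets_gauss; move: (sum_charF2_hyperbolic k).
(* Substituting u M turns the hyperbolic form into that of [indicator_quad]. *)
rewrite (reindex (fun u => u *m M)); last first.
  by exists (fun u => u *m M') => u _; rewrite -mulmxA ?MM' ?M'M mulmx1.
rewrite (reindex _ (onW_bij _ (@indicator_bij (k + k)))) /=.
congr (_ < _); apply: eq_bigr => S _.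
by rewrite mul_mx_row row_mxKl row_mxKr indicator_quad // charF2_nat.
Qed.

End LowerBounds.

(** * Values of b_2 by residue modulo 8 *)

Lemma b2_eq n k :
  has_odd_cover n k -> (forall j, has_odd_cover n j -> k <= j) -> b2 n = k.
Proof.
move=> cover_k min_k; rewrite /b2; case: ex_minnP => j cover_j min_j.
by apply/eqP; rewrite eqn_leq min_j ?min_k.
Qed.

(** Deleting a vertex gives n - 1 <= 2k, so a smaller k would force n = 2k + 1. *)
Lemma cover_lower_odd n k : odd n -> 2 <= n -> has_odd_cover n k -> uphalf n <= k.
Proof.
move=> n_odd n_ge2 cover_k; rewrite leqNgt; apply/negP=> lt_k.
have lower : n.-1 <= k + k.
  by apply: cover_lower_even (has_odd_cover_le (leq_pred n) cover_k); lia.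
have k_gt0 : 0 < k by lia.
have nE : n = (k + k).+1 by lia.
by move: cover_k; rewrite nE => cover_k; move: (no_cover_odd k_gt0); rewrite cover_k.
Qed.

Lemma cover_lower_half n k : ~~ odd n -> has_odd_cover n k -> n./2 <= k.
Proof. by move=> n_even /(cover_lower_even n_even); lia. Qed.

Lemma has_odd_cover_odd n : odd n -> 2 <= n -> has_odd_cover n (uphalf n).
Proof.
move=> n_odd n_ge2; have [->|n3] := eqVneq n 3; first exact: has_odd_cover_3_2.
have [->|n5] := eqVneq n 5; first exact: has_odd_cover_5_3.
have : [|| n %% 8 == 1, n %% 8 == 3, n %% 8 == 5 | n %% 8 == 7] by lia.
case/or4P => /eqP nE.
- by have := has_odd_cover_mod1 (n %/ 8); congr has_odd_cover; lia.
- by have := has_odd_cover_mod3 (n %/ 8).-1; congr has_odd_cover; lia.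
- by have := has_odd_cover_mod5 (n %/ 8).-1; congr has_odd_cover; lia.
(* For residue 7, delete a vertex from a cover of order n + 1. *)
have := has_odd_cover_mod0 (n %/ 8).+1.
have -> : 0 + 4 * (n %/ 8).+1 = uphalf n by lia.
by apply: has_odd_cover_le; lia.
Qed.

Lemma has_odd_cover_even n : ~~ odd n -> 2 <= n -> has_odd_cover n (n./2 + 1).
Proof.
move=> n_even n_ge2; apply: (@has_odd_cover_le _ n.+1); first by [].
by have := @has_odd_cover_odd n.+1; rewrite /= n_even addn1; apply=> //; lia.
Qed.

Lemma b2_even_of_no_cover n :
  ~~ odd n -> ~~ has_odd_cover n n./2 -> 2 <= n -> b2 n = n./2 + 1.
Proof.
move=> n_even no_cover n_ge2; apply: b2_eq; first exact: has_odd_cover_even.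
move=> j cover_j; have := cover_lower_half n_even cover_j.
rewrite leq_eqVlt addn1 => /orP[/eqP eq_j|//].
by move: no_cover; rewrite eq_j cover_j.
Qed.

Theorem theorem5 (n : nat) (hn : 2 <= n) :
  [/\ odd n -> b2 n = uphalf n,
      n = 0 %[mod 8] -> b2 n = n./2,
      n = 2 %[mod 8] -> n <> 10 -> b2 n = n./2,
      n = 4 %[mod 8] \/ n = 6 %[mod 8] -> b2 n = n./2 + 1
    & n = 10 -> b2 n = 6].
Proof.
split=> [n_odd|n0|n2 n10|n46|->].
- by apply: b2_eq => [|j]; [exact: has_odd_cover_odd | exact: cover_lower_odd].
- apply: b2_eq => [|j]; last by apply: cover_lower_half; lia.
  by have := has_odd_cover_mod0 (n %/ 8); congr has_odd_cover; lia.
- apply: b2_eq => [|j]; last by apply: cover_lower_half; lia.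
  (* Beyond 2 and the excluded 10, the residue class starts at the base order 18. *)
  have [->|n_neq2] := eqVneq n 2; first exact: has_odd_cover_2_1.
  by have := has_odd_cover_mod2 (n %/ 8 - 2); congr has_odd_cover; lia.
- apply: b2_even_of_no_cover => //; first by lia.
  have nE : n = n./2 + n./2 by lia.
  apply/negP; rewrite {1}nE => /cover_tight_mod8; rewrite -nE; lia.
- exact: (@b2_even_of_no_cover 10 isT no_cover_10 isT).
Qed.
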